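(* For every integer $L\geq 0$, \[ \sum_{j=-\infty}^{\infty}(-1)^jq^{2j^2-j}{2L \brack L-2j-1}_q=(-q^2;q^2)_{L-2}\left\{(1+q^L)(1-q^{2L})+q^{L-1}(1-q^L)(1+q^2)\right\}. \]
   Context: For integers $n\geq 0$, $(a;q)_n=\prod_{j=0}^{n-1}(1-aq^j)$ and $(a;q)_{-n}=1/(a/q;1/q)_n$ (so, with base $q^2$, $(a;q^2)_{-n}=1/(aq^{-2};q^{-2})_n$); $(q)_n=(q;q)_n$. For integers $m,n$, ${n+m \brack n}_q=\frac{(q)_{n+m}}{(q)_n(q)_m}$ if $m,n\geq 0$ and $0$ otherwise. *)

(* Defs.v *)
From HB Require Import structures.
From mathcomp Require Import all_boot all_order all_algebra.
From mathcomp Require Import boolp classical_sets cardinality fsbigop.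
From mathcomp Require Import zify.
Set Implicit Arguments.
Unset Strict Implicit.
Unset Printing Implicit Defensive.
Import Order.TTheory GRing.Theory Num.Theory.
Local Open Scope ring_scope.

Definition qpoch_nat (F : fieldType) (a q : F) (n : nat) : F :=
  \prod_(j < n) (1 - a * q ^+ j).

(* [Negz n] is [- n.+1], hence the shifted index in the second branch:
   (a; q)_{-n} = 1 / (a / q; 1 / q)_n. *)
Definition qpoch (F : fieldType) (a q : F) (n : int) : F :=
  match n with
  | Posz n => qpoch_nat a q n
  | Negz n => (qpoch_nat (a / q) q^-1 n.+1)^-1
  end.

(* [qbinom q N k] is the Gaussian binomial with upper entry N and lower
   entry k; as a quotient it is meaningful only when q is not a root of
   unity. *)
Definition qbinom (F : fieldType) (q : F) (N k : int) : F :=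
  if (0 <= k) && (0 <= N - k) then
    qpoch q q N / (qpoch q q k * qpoch q q (N - k))
  else 0.

(* [\sum_(j \in [set: int]) f j] is the sum over the support of f when that
   support is finite, and 0 otherwise; the support is finite here. *)
Lemma finite_support_qbinom_sum (F : fieldType) (q : F) (L : nat) :
  finite_set [set j : int | (-1) ^ j * q ^ (2 * j ^+ 2 - j)
     * qbinom q (2 * L%:Z) (L%:Z - 2 * j - 1) != 0]%classic.
Proof.
apply: (@sub_finite_set _ _
  [set` [seq i%:Z - L.+1%:Z | i <- iota 0 (2 * L.+1)]]%classic); last first.
  exact: finite_seq.
move=> j /=; rewrite /qbinom; case: ifP => [h _|_]; last by rewrite mulr0 eqxx.
suff /mapP : exists2 i, i \in iota 0 (2 * L.+1) & j = i%:Z - L.+1%:Z by [].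
by exists (absz (j + L.+1%:Z)); [rewrite mem_iota|]; lia.
Qed.

(* Main.v *)
Require Import Defs.
From HB Require Import structures.
From mathcomp Require Import all_boot all_order all_algebra all_field.
From mathcomp Require Import boolp classical_sets cardinality fsbigop.
From mathcomp Require Import zify ring.
Set Implicit Arguments.
Unset Strict Implicit.
Unset Printing Implicit Defensive.
Import Order.TTheory GRing.Theory Num.Theory.
Local Open Scope ring_scope.

(* With k = 2j + 1 the exponent 2j^2 - j is k(k-1)/2 - k + 1, so over a field
   containing a square root i of -1 the sum is q/(2i) (P(i) - P(-i)), where P(x)
   is the sum over all k of x^k q^(k(k-1)/2 - k) [2L, L-k].  The q-binomial
   theorem gives P(i) = (-i/q; q)_L (i q^2; q)_L; pairing the factors 1 + i q^m
   and 1 - i q^m turns this into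
     (i/q)(1 + i) (-q^2; q^2)_{L-2} (1 - i q^(L-1))(1 - i q^L)(1 - i q^(L+1)).
   A field without such an i is first embedded in one that has it. *)

(** * Gaussian binomials and the q-binomial theorem *)

Lemma qpoch_natS (F : fieldType) (a q : F) n :
  qpoch_nat a q n.+1 = qpoch_nat a q n * (1 - a * q ^+ n).
Proof. by rewrite /qpoch_nat big_ord_recr. Qed.

Lemma qpoch_nat_neq0 (F : fieldType) (q : F) n :
  (forall m, (0 < m)%N -> q ^+ m != 1) -> qpoch_nat q q n != 0.
Proof.
move=> q_not_root1; apply/prodf_neq0 => i _.
by rewrite -exprS subr_eq0 eq_sym q_not_root1.
Qed.

Lemma qbinomE (F : fieldType) (q : F) (N k : nat) : (k <= N)%N ->
  qbinom q N%:Z k%:Z =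
    qpoch_nat q q N / (qpoch_nat q q k * qpoch_nat q q (N - k)).
Proof. by move=> kN; rewrite /qbinom ifT ?subzn //; lia. Qed.

Lemma qbinom0 (F : fieldType) (q : F) (N : nat) :
  (forall m, (0 < m)%N -> q ^+ m != 1) -> qbinom q N%:Z 0 = 1.
Proof.
move=> q_not_root1; rewrite (@qbinomE _ q N 0%N) // subn0.
by rewrite [qpoch_nat _ _ 0]big_ord0 mul1r divff ?qpoch_nat_neq0.
Qed.

Lemma qbinom_gt (F : fieldType) (q : F) (N k : nat) : (N < k)%N ->
  qbinom q N%:Z k%:Z = 0.
Proof. by move=> kN; rewrite /qbinom ifF //; lia. Qed.

Lemma qbinom_pascal (F : fieldType) (q : F) (N k : nat) :
    (forall m, (0 < m)%N -> q ^+ m != 1) -> (k <= N)%N ->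
  qbinom q N.+1%:Z k.+1%:Z =
    qbinom q N%:Z k.+1%:Z + q ^+ (N - k) * qbinom q N%:Z k%:Z.
Proof.
move=> q_not_root1; rewrite leq_eqVlt => /orP[/eqP->|kN].
  (* At k = N the first term on the right is 0 by convention, not by the quotient formula. *)
  rewrite (qbinom_gt _ (ltnSn N)) !qbinomE // !subnn expr0 mul1r add0r.
  by rewrite /qpoch_nat big_ord0 !mulr1 !divff //; apply: qpoch_nat_neq0.
(* Writing N = k + d + 1 removes the truncated subtractions. *)
have [d ->] : exists d, N = (k + d.+1)%N by exists (N - k.+1)%N; lia.
rewrite !qbinomE; try lia.
rewrite subSS addKn (_ : (k + d.+1 - k.+1)%N = d); last by lia.
rewrite !qpoch_natS.
have := qpoch_nat_neq0 k q_not_root1; have := qpoch_nat_neq0 d q_not_root1.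
have := q_not_root1 k.+1 isT; have := q_not_root1 d.+1 isT.
rewrite ![_ == 1]eq_sym -!(subr_eq0 1) !exprD !exprS.
by move=> hd hk hPd hPk; field; rewrite hd hk hPd hPk.
Qed.

Lemma q_binomial_theorem (F : fieldType) (q x : F) (N : nat) :
    (forall m, (0 < m)%N -> q ^+ m != 1) ->
  \sum_(k < N.+1) q ^+ 'C(k, 2) * qbinom q N%:Z k%:Z * x ^+ k =
  qpoch_nat (- x) q N.
Proof.
move=> q_not_root1; elim: N => [|N IHN].
  by rewrite big_ord1 qbinomE // /qpoch_nat !big_ord0 !mulr1 invr1 !mulr1.
rewrite qpoch_natS -{}IHN big_ord_recl.
under eq_bigr => k _ do
  rewrite qbinom_pascal ?[bump _ _]add1n -1?ltnS // mulrDr mulrDl.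
rewrite big_split /= addrA mulNr opprK [RHS]mulrDr !mulr1; congr (_ + _).
  (* The k = 0 term completes the first half of Pascal's rule, whose top term k = N + 1 vanishes. *)
  rewrite [RHS](_ : _ =
    \sum_(k < N.+2) q ^+ 'C(k, 2) * qbinom q N%:Z k%:Z * x ^+ k).
    rewrite [RHS]big_ord_recl mulr1; congr (_ + _).
    by rewrite !qbinom0.
  by rewrite [RHS]big_ord_recr /= qbinom_gt // mulr0 mul0r addr0.
rewrite mulr_suml; apply: eq_bigr => k _.
rewrite binS bin1 exprD exprS.
have -> : q ^+ N = q ^+ k * q ^+ (N - k) by rewrite -exprD subnKC // -ltnS.
by ring.
Qed.

(** * Extension of the field and reduction to a finite sum *)

Lemma exists_sqrt_opp1 (F : fieldType) :
  exists (K : fieldType) (f : {rmorphism F -> K}) (i : K), i ^+ 2 = -1.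
Proof.
have [[i ii]|noi] := pselect (exists i : F, i ^+ 2 = -1).
  by exists F, idfun, i.
(* A quadratic without a root in F is irreducible, so a root can be adjoined. *)
have Xr : irreducible_poly ('X^2 + 1%:P : {poly F}).
  apply: cubic_irreducible; first by rewrite size_XnaddC.
  move=> x; apply/negP; rewrite /root !hornerE addr_eq0 => /eqP xx.
  by apply: noi; exists x.
have [K _ [i ri _]] := irredp_FAdjoin Xr.
exists K, (GRing.in_alg K), i; apply/eqP; rewrite -addr_eq0.
by move: ri; rewrite rmorphD /= map_polyXn map_polyC /= scale1r /root !hornerE.
Qed.

Lemma rmorph_qpoch_nat (F K : fieldType) (f : {rmorphism F -> K}) (a q : F) n :
  f (qpoch_nat a q n) = qpoch_nat (f a) (f q) n.
Proof.
rewrite rmorph_prod; apply: eq_bigr => j _.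
by rewrite rmorphB rmorph1 rmorphM rmorphXn.
Qed.

Lemma rmorph_qpoch (F K : fieldType) (f : {rmorphism F -> K}) (a q : F) n :
  f (qpoch a q n) = qpoch (f a) (f q) n.
Proof.
by case: n => n; rewrite /= ?fmorphV rmorph_qpoch_nat // fmorph_div fmorphV.
Qed.

Lemma rmorph_qbinom (F K : fieldType) (f : {rmorphism F -> K}) (q : F) N k :
  f (qbinom q N k) = qbinom (f q) N k.
Proof.
rewrite /qbinom; case: ifP => _; last exact: rmorph0.
by rewrite fmorph_div rmorphM !rmorph_qpoch.
Qed.

(* The substitution [k = L - 2 * j - 1]. *)
Lemma fsbig_qbinom (F : fieldType) (q : F) (c : int -> F) (L : nat) :
  \sum_(j \in [set: int]%classic) c j * qbinom q (2 * L%:Z) (L%:Z - 2 * j - 1) =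
  \sum_(k < (2 * L).+1 | odd (L + k))
    c (((L%:Z - k%:Z - 1) %/ 2)%Z) * qbinom q (2 * L)%:Z k%:Z.
Proof.
pose h (k : nat) : int := ((L%:Z - k%:Z - 1) %/ 2)%Z.
pose s := [seq h k | k <- index_iota 0 (2 * L).+1 & odd (L + k)].
(* Outside [s] the lower entry leaves [0, 2L], where [qbinom] is 0 by convention. *)
rewrite -(fsbig_widen [set` s]%classic) //.
- rewrite -fsbig_seq; last first.
    rewrite map_inj_in_uniq ?filter_uniq ?iota_uniq // => k l.
    by rewrite !mem_filter /h => /andP[? _] /andP[? _]; lia.
  rewrite big_map big_filter big_mkord.
  apply: eq_bigr => k Lk; congr (_ * qbinom _ _ _); rewrite /h; lia.
- move=> /= j [_]; rewrite /= /qbinom.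
  case: ifP => [jL []|_ _]; last by rewrite mulr0.
  apply/mapP; exists (absz (L%:Z - 2 * j - 1)%R);
    rewrite ?mem_filter ?mem_index_iota /h; lia.
Qed.

(** * Evaluation of the product at a square root of -1 *)

Lemma qpoch_natD (F : fieldType) (a q : F) m n :
  qpoch_nat a q (m + n) = qpoch_nat a q m * qpoch_nat (a * q ^+ m) q n.
Proof.
rewrite /qpoch_nat big_split_ord /=; congr (_ * _).
by apply: eq_bigr => j _; rewrite exprD mulrA.
Qed.

(** Since i^2 = -1, i q^(-m) (1 - i q^m) = 1 + i q^(-m). Multiplying over m from 2 - L to 1 reverses
    the product; the prefactor collects the monomials i q^(-m). *)
Lemma qpoch_nat_reverse (K : fieldType) (i q : K) (L : nat) :
    q != 0 -> i ^+ 2 = -1 ->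
  q ^ ('C(L, 2)%:Z - L%:Z) * i ^+ L * qpoch_nat (i * q ^ (2 - L%:Z)) q L =
  qpoch_nat (- (i / q)) q L.
Proof.
move=> q0 ii; elim: L => [|L IHL]; first by rewrite /qpoch_nat !big_ord0 !mulr1.
rewrite [RHS]qpoch_natS -{}IHL (qpoch_natD _ _ 1 L).
rewrite [qpoch_nat _ _ 1]big_ord1 expr0 expr1 mulr1.
have -> : i * q ^ (2 - L.+1%:Z) * q = i * q ^ (2 - L%:Z).
  by rewrite -mulrA -{2}[q]expr1z -expfzDr //; congr (_ * _ ^ _); lia.
rewrite binS bin1.
have -> : ('C(L, 2) + L)%N%:Z - L.+1%:Z =
    ('C(L, 2)%:Z - L%:Z) + (L%:Z - 1) by lia.
have -> : 2 - L.+1%:Z = - (L%:Z - 1) by lia.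
rewrite [q ^ (_ + (L%:Z - 1))]expfzDr // -invr_expz.
rewrite [q ^ (L%:Z - 1)]expfzDr // exprN1 exprS -exprnP.
have qL0 : q ^+ L != 0 by rewrite expf_neq0.
move: (qpoch_nat _ _ _) (q ^ ('C(L, 2)%:Z - _)) (i ^+ L) (q ^+ L) qL0
  => P A B C C0.
(* The middle form exposes [i ^+ 2], to be rewritten by [ii]. *)
transitivity (A * B * P * (i * C / q - i ^+ 2)); first by field; rewrite C0 q0.
by rewrite ii; field.
Qed.

(** The 2L factors are cut in the middle: the lower half is reversed, the upper half starts at i
    q^2. *)
Lemma finite_triple_product (K : fieldType) (i q : K) (L : nat) :
    q != 0 -> i ^+ 2 = -1 ->
  q ^ ('C(L, 2)%:Z - L%:Z) * i ^+ L * qpoch_nat (i * q ^ (2 - L%:Z)) q (2 * L) =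
  qpoch_nat (- (i / q)) q L * qpoch_nat (i * q ^+ 2) q L.
Proof.
move=> q0 ii; rewrite mul2n -addnn qpoch_natD mulrA qpoch_nat_reverse //.
by rewrite -mulrA exprnP -expfzDr // subrK.
Qed.

(** The factor 1 + q^(-2) is inverted in (-q^2; q^2)_{-2}, reached at L = 0. *)
Lemma sqrD1_neq0 (F : fieldType) (q : F) : q ^+ 4 != 1 -> q ^+ 2 + 1 != 0.
Proof.
move=> q4; apply: contraNneq q4 => /eqP; rewrite addr_eq0 => /eqP q2.
by rewrite (exprM q 2 2) q2 sqrrN expr1n.
Qed.

Lemma qpoch_shift (F : fieldType) (q : F) (L : nat) :
    q != 0 -> (forall n : nat, (0 < n)%N -> q ^+ n != 1) -> 2%:R != 0 :> F ->
  qpoch (- q ^+ 2) (q ^+ 2) (L.+1%:Z - 2) =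
  qpoch (- q ^+ 2) (q ^+ 2) (L%:Z - 2) * (1 + (q ^ (L%:Z - 1)) ^+ 2).
Proof.
move=> q0 q_not_root1 two0; have q2 := sqrD1_neq0 (q_not_root1 4 isT).
have qq : - q ^+ 2 / q ^+ 2 = -1 by rewrite mulNr divff ?expf_neq0.
(* For L = 0 and 1 the index runs through -2, -1, 0, with values 1/(2(1 + q^(-2))), 1/2, 1. *)
case: L => [|[|L]].
- rewrite /= qq /qpoch_nat !big_ord_recr !big_ord0 /= expr0 expr1.
  rewrite exprN1 !mulN1r !opprK.
  by field; rewrite q0 q2 two0.
- rewrite (_ : 1%Z - 1 = 0) // expr0z /= qq /qpoch_nat.
  rewrite !big_ord_recr !big_ord0 /= !mulN1r !opprK.
  by field; rewrite q0 two0.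
have -> : L.+3%:Z - 2 = L.+1%:Z by lia.
have -> : L.+2%:Z - 2 = L%:Z by lia.
have -> : L.+2%:Z - 1 = L.+1%:Z by lia.
by rewrite /= qpoch_natS -exprnP mulNr opprK -exprS -!exprM mulnC.
Qed.

(** Passing from L to L + 1 adds 1 + i q^(L-1), which pairs with 1 - i q^(L-1) to give 1 + q^(2L-2),
    and 1 - i q^(L+2), which restores three consecutive factors. *)
Lemma triple_product_closed_form (K : fieldType) (i q : K) (L : nat) :
    q != 0 -> (forall n : nat, (0 < n)%N -> q ^+ n != 1) -> 2%:R != 0 :> K ->
    i ^+ 2 = -1 ->
  qpoch_nat (- (i / q)) q L * qpoch_nat (i * q ^+ 2) q L =
  i / q * (1 + i) * qpoch (- q ^+ 2) (q ^+ 2) (L%:Z - 2)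
  * ((1 - i * q ^ (L%:Z - 1)) * (1 - i * q ^+ L) * (1 - i * q ^+ L.+1)).
Proof.
move=> q0 q_not_root1 two0 ii; elim: L => [|L IHL].
  have q2 := sqrD1_neq0 (q_not_root1 4 isT).
  have qq : - q ^+ 2 / q ^+ 2 = -1 by rewrite mulNr divff ?expf_neq0.
  rewrite [LHS](_ : _ = 1); last by rewrite /qpoch_nat !big_ord0 mulr1.
  rewrite /= qq /qpoch_nat !big_ord_recr !big_ord0 /=.
  rewrite expr0 !expr1 exprN1 !mulN1r !opprK.
  (* Here (1 + i)(1 - i) cancels the 2, and (i/q)(1 - i/q)(1 - i q) the 1 + q^(-2), in the
     denominator of [qpoch]. *)
  transitivity ((1 - i ^+ 2) *
    (- i ^+ 2 * (1 + q ^- 2) + i / q * (1 + i ^+ 2)) / (2 * (1 + q ^- 2)));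
    first by rewrite ii; field; rewrite ?q0 ?q2 ?two0.
  by field; rewrite ?q0 ?q2 ?two0.
rewrite !qpoch_natS mulrACA {}IHL qpoch_shift //.
have -> : q ^ (L.+1%:Z - 1) = q ^+ L by rewrite -[L.+1]addn1 PoszD addrK.
rewrite -mulrA -[i * q ^+ 2 * _]mulrA -exprD add2n.
have -> : - (i / q) * q ^+ L = - (i * q ^ (L%:Z - 1)).
  by rewrite mulNr -mulrA expfzDr // exprN1 [q ^ _ * _]mulrC exprnP.
move: (qpoch _ _ _) (q ^ _) => Q a; rewrite !exprS.
transitivity (i / q * (1 + i) * Q * (1 - i ^+ 2 * a ^+ 2) *
  ((1 - i * q ^+ L) * (1 - i * (q * q ^+ L)) *
   (1 - i * (q * (q * q ^+ L))))); first by ring.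
by rewrite ii; ring.
Qed.

(** * Extraction of the odd part and conclusion *)

Lemma sqrt_opp1_neq0 (K : fieldType) (i : K) : i ^+ 2 = -1 -> i != 0.
Proof. by move=> ii; rewrite -sqrf_eq0 ii oppr_eq0 oner_eq0. Qed.

Lemma opp_sqrt_opp1 (K : fieldType) (i : K) : i ^+ 2 = -1 -> - i = i^-1.
Proof.
move=> ii; have i0 := sqrt_opp1_neq0 ii.
by apply: (mulfI i0); rewrite mulrN divff // -expr2 ii opprK.
Qed.

(** As -i = 1/i, the powers of i merge into one that depends only on L - k. *)
Lemma q_binomial_summand (K : fieldType) (i q : K) (L k : nat) :
    q != 0 -> i ^+ 2 = -1 ->
  q * q ^ ('C(L, 2)%:Z - L%:Z) * i ^+ L
  * (q ^+ 'C(k, 2) * (- (i * q ^ (2 - L%:Z))) ^+ k) =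
  i ^ (L%:Z - k%:Z)
  * q ^ (1 + ('C(L, 2)%:Z - L%:Z) + 'C(k, 2)%:Z + (2 - L%:Z) * k%:Z).
Proof.
move=> q0 ii; rewrite -mulNr opp_sqrt_opp1 // exprMn exprVn.
rewrite (expfzDr _ _ (sqrt_opp1_neq0 ii)) -invr_expz -!exprnP.
move: (2 - _) ('C(L, 2)%:Z - _) => e g.
by rewrite !(expfzDr _ _ q0) expr1z -exprz_exp -!exprnP; ring.
Qed.

Lemma bin2_double (n : nat) : 2 * 'C(n, 2)%:Z = n%:Z ^+ 2 - n%:Z.
Proof. by have := mul_bin_diag n 1; rewrite bin1; case: n => [|n] /=; lia. Qed.

(* [i ^ m - (- i) ^ m] selects the odd [m]. *)
Lemma q_binomial_odd_part (K : fieldType) (i q : K) (L k : nat) :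
    q != 0 -> i ^+ 2 = -1 ->
  let j := ((L%:Z - k%:Z - 1) %/ 2)%Z in
  q * q ^ ('C(L, 2)%:Z - L%:Z) * i ^+ L
  * (q ^+ 'C(k, 2) * (- (i * q ^ (2 - L%:Z))) ^+ k)
  - q * q ^ ('C(L, 2)%:Z - L%:Z) * (- i) ^+ L
    * (q ^+ 'C(k, 2) * (- (- i * q ^ (2 - L%:Z))) ^+ k) =
  2 * i * (if odd (L + k) then (-1) ^ j * q ^ (2 * j ^+ 2 - j) else 0).
Proof.
move=> q0 ii j; rewrite !q_binomial_summand ?sqrrN // -mulrBl.
have i0 := sqrt_opp1_neq0 ii; have Ni0 : - i != 0 by rewrite oppr_eq0.
have E2 (x : K) n : x ^+ 2 = -1 -> x ^ (2 * n) = (-1) ^ n.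
  by move=> xx; rewrite -exprz_exp -exprnP xx.
case: ifP => Lk; last first.
  (* For L - k even, flooring gives j = (L - k)/2 - 1; both powers equal (-1)^(j+1) and cancel. *)
  have -> : L%:Z - k%:Z = 2 * (j + 1) by rewrite /j; lia.
  by rewrite !E2 ?sqrrN // subrr mul0r mulr0.
have Lkj : L%:Z = k%:Z + 2 * j + 1 by rewrite /j; lia.
have -> : L%:Z - k%:Z = 2 * j + 1 by rewrite Lkj; ring.
rewrite (expfzDr _ _ i0) (expfzDr _ _ Ni0) !E2 ?sqrrN // !expr1z.
(* With n = L - k = 2j + 1 this exponent is n(n-1)/2 - n + 1; doubling turns the binomials into
   polynomials. *)
have -> : 1 + ('C(L, 2)%:Z - L%:Z) + 'C(k, 2)%:Z + (2 - L%:Z) * k%:Z =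
    2 * j ^+ 2 - j.
  apply: (@mulfI _ (2 : int)) => //.
  have -> (a b c d : int) : 2 * (1 + (a - b) + c + d) =
      2 + 2 * a - 2 * b + 2 * c + 2 * d by ring.
  by rewrite !bin2_double Lkj; ring.
by ring.
Qed.

Lemma qbinom_sum_sqrt_opp1 (K : fieldType) (i q : K) (L : nat) :
    q != 0 -> (forall n : nat, (0 < n)%N -> q ^+ n != 1) -> 2%:R != 0 :> K ->
    i ^+ 2 = -1 ->
  \sum_(k < (2 * L).+1 | odd (L + k))
     (let j := ((L%:Z - k%:Z - 1) %/ 2)%Z in (-1) ^ j * q ^ (2 * j ^+ 2 - j))
     * qbinom q (2 * L)%:Z k%:Z
  = qpoch (- q ^+ 2) (q ^+ 2) (L%:Z - 2)
    * ((1 + q ^+ L) * (1 - q ^+ (2 * L))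
       + q ^ (L%:Z - 1) * (1 - q ^+ L) * (1 + q ^+ 2)).
Proof.
move=> q0 q_not_root1 two0 ii; have i0 := sqrt_opp1_neq0 ii.
have Nii : (- i) ^+ 2 = -1 by rewrite sqrrN.
apply: (mulfI (mulf_neq0 two0 i0)); rewrite big_mkcond mulr_sumr.
(* For x^2 = -1, [A x] is q P(x) with the summation index reflected to L - k. *)
pose A (x : K) := q * q ^ ('C(L, 2)%:Z - L%:Z) * x ^+ L *
  (\sum_(k < (2 * L).+1) q ^+ 'C(k, 2) * qbinom q (2 * L)%:Z k%:Z
     * (- (x * q ^ (2 - L%:Z))) ^+ k).
transitivity (A i - A (- i)).
  rewrite /A !mulr_sumr -sumrB; apply: eq_bigr => k _.
  have := q_binomial_odd_part L k q0 ii.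
  move: (qbinom _ _ _) => B /(congr1 ( *%R^~ B)).
  by case: ifP => _ /= E; rewrite ?mulr0 ?mul0r in E *; rewrite ?mulrA in E *;
     rewrite -E; ring.
have AE x : x ^+ 2 = -1 -> A x = q * (x / q * (1 + x) *
    qpoch (- q ^+ 2) (q ^+ 2) (L%:Z - 2) * ((1 - x * q ^ (L%:Z - 1)) *
    (1 - x * q ^+ L) * (1 - x * q ^+ L.+1))).
  move=> xx; rewrite /A q_binomial_theorem // opprK.
  by rewrite -triple_product_closed_form // -finite_triple_product // !mulrA.
rewrite !AE // mulnC exprM (exprS q L).
have -> : q ^+ L = q * q ^ (L%:Z - 1).
  by rewrite expfzDr // exprN1 mulrCA divff // mulr1.
move: (qpoch _ _ _) (q ^ _) => Q a.
(* With a = q^(L-1), this is twice the part odd in i of i (1 + i) Q (1 - i a)(1 - i q a)(1 - i q^2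
   a). *)
transitivity (2 * i * Q * (1
    + i ^+ 2 * ((q + q ^+ 2 + q ^+ 3) * a ^+ 2 - (1 + q + q ^+ 2) * a)
    - (i ^+ 2) ^+ 2 * (q ^+ 3 * a ^+ 3))).
  by field.
by rewrite ii; ring.
Qed.

Theorem theorem3p1 (F : fieldType) (q : F) (q_neq0 : q != 0)
    (q_not_root1 : forall n : nat, (0 < n)%N -> q ^+ n != 1)
    (two_neq0 : 2%:R != 0 :> F) (L : nat) :
  \sum_(j \in [set: int]%classic)
     (-1) ^ j * q ^ (2 * j ^+ 2 - j)
     * qbinom q (2 * L%:Z) (L%:Z - 2 * j - 1)
  = qpoch (- q ^+ 2) (q ^+ 2) (L%:Z - 2)
    * ((1 + q ^+ L) * (1 - q ^+ (2 * L))
       + q ^ (L%:Z - 1) * (1 - q ^+ L) * (1 + q ^+ 2)).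
Proof.
have [K [f [i ii]]] := exists_sqrt_opp1 F.
(* Once the sum is finite, the injective [f] can be pushed through it. *)
rewrite fsbig_qbinom; apply: (fmorph_inj f).
rewrite rmorph_sum; under eq_bigr => k _ do
  rewrite !rmorphM !fmorphXz rmorphN1 rmorph_qbinom.
rewrite (qbinom_sum_sqrt_opp1 (i := i)) ?fmorph_eq0 //.
- rewrite rmorphM rmorph_qpoch.
  by rewrite !(rmorphM, rmorphD, rmorphN, rmorph1, rmorphXn, fmorphXz).
- by move=> n n0; rewrite -rmorphXn fmorph_eq1 q_not_root1.
- by rewrite -(rmorph_nat f) fmorph_eq0.
Qed.
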